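(* Let $f$ be any Riemann integrable function in $L^m[0,1]$. For each positive integer $n$, let $A_{f,n}$ be the symmetric $n\times n$ matrix whose $(i,j)$ entry is $f\bigl(\min(i,j)/\max(i,j)\bigr)$ for $1\le i,j\le n$. Then \[ \lim_{n\rightarrow\infty}\frac{1}{n^2}\|A_{f,n}\|_m^m=\lim_{n\rightarrow\infty}\frac{1}{n}\sum_{i=1}^{n}f^m(i/n)=\int_0^1f^m(x)\,dx. \]
   Context: $\|A\|_m$ denotes the $m$-norm of a matrix $A=(a_{ij})$, taken entrywise: $\|A\|_m^m=\sum_{i,j}|a_{ij}|^m$. $f^m$ denotes the $m$-th power of $f$.
   Formalization: The first equality fails for odd m when f takes negative values (f = -1, m = 1 gives 1 and -1); it is stated for f^m when m is even or f >= 0 on [0,1], and for all f with |f|^m in place of f^m; the second equality is stated for all f. Here m is a positive integer and f is real-valued. *)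

(* Defs.v *)
(* Stdlib reals with Coquelicot. *)
From Stdlib Require Export Reals.
From Coquelicot Require Export Coquelicot.

Open Scope R_scope.

(* Coquelicot matrices are indexed from 0, hence the shifts between the
   1-based indices i, j of the mathematics and the stored indices. *)

Definition minmax_matrix (f : R -> R) (n : nat) : @matrix R n n :=
  mk_matrix n n (fun i j : nat =>
    f (INR (Nat.min (S i) (S j)) / INR (Nat.max (S i) (S j)))).

(* The m-th power of the entrywise m-norm. *)
Definition norm_pow (m : nat) {p q : nat} (A : @matrix R p q) : R :=
  sum_n_m (fun i : nat =>
    sum_n_m (fun j : nat =>
      Rabs (coeff_mat 0 A (Nat.pred i) (Nat.pred j)) ^ m) 1 q) 1 p.

Definition sample_mean (g : R -> R) (n : nat) : R :=
  / INR n * sum_n_m (fun i : nat => g (INR i / INR n)) 1 n.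

(* Main.v *)
Require Import Defs.
From Stdlib Require Import Reals List Lra Lia.
From Coquelicot Require Import Coquelicot.

(** Write [g] for [fun x => f x ^ m] or [fun x => Rabs (f x) ^ m], and
    S_k for [sample_mean g k], the right-tagged Riemann sum of [g] over the
    uniform subdivision of [0,1] into k parts.

    The function [g] is Riemann integrable because [f] is bounded and a power
    is Lipschitz on bounded sets: a Lipschitz function maps a step
    approximation of [f] with small error to a step approximation of [g] with
    small error ([ex_RInt_comp_lipschitz], [ex_RInt_pow]).  Hence S_k tends to
    the integral of [g] ([is_lim_seq_sample_mean]).

    For the matrix, peel off its last row and column.  In a symmetric n x n
    matrix with entries g(min(i,j)/max(i,j)), the last column is
    g(1/n), ..., g(n/n), so the border contributes 2 n S_n - g(1), the corner
    being counted once.  Therefore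
      sum_(i,j <= n) g(min(i,j)/max(i,j)) = sum_(k <= n) (2 k S_k - g(1)),
    which is [sum_minmax_sample_mean].  Since n^2 is the sum of the weights
    2k - 1 for k <= n, dividing by n^2 gives a weighted Cesaro mean of the
    numbers (2 k S_k - g(1)) / (2k - 1), and these have the same limit as S_k
    ([is_lim_seq_minmax_mean]). *)

(** * Lipschitz functions and powers of Riemann integrable functions *)

Lemma is_subdivision_comp (h phi : R -> R) (a b : R) (l : list R) :
  is_subdivision phi a b l -> is_subdivision (fun x => h (phi x)) a b l.
Proof.
  intros [lf (Hord & Hmin & Hmax & Hlen & Hconst)].
  exists (List.map h lf).
  repeat split; try assumption.
  - now rewrite List.length_map.
  - intros i Hi x Hx.
    rewrite RList.RList_P12; [|rewrite Hlen in Hi; exact Hi].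
    now rewrite (Hconst i Hi x Hx).
Qed.

Definition step_comp (h : R -> R) {a b : R} (phi : StepFun a b) : StepFun a b :=
  mkStepFun (existT _ (subdivision phi)
    (is_subdivision_comp h phi a b _ (StepFun_P29 phi))).

Lemma step_scal (L a b : R) (psi : StepFun a b) :
  {psi' : StepFun a b |
    (forall x, psi' x = L * psi x) /\ RiemannInt_SF psi' = L * RiemannInt_SF psi}.
Proof.
  exists (mkStepFun (StepFun_P28 L (mkStepFun (StepFun_P4 a b 0)) psi)).
  split.
  - intros x; simpl; unfold fct_cte; ring.
  - rewrite StepFun_P30, StepFun_P18; ring.
Qed.

(** If [phi] approximates [f] with error at most [psi], then [h] after [phi]
    approximates [h] after [f] with error at most [L * psi]. *)
Lemma ex_RInt_comp_lipschitz_global (f h : R -> R) (a b L : R) :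
  0 <= L ->
  (forall x y, Rabs (h x - h y) <= L * Rabs (x - y)) ->
  ex_RInt f a b -> ex_RInt (fun x => h (f x)) a b.
Proof.
  intros HL Hh Hf.
  apply ex_RInt_Reals_1; apply ex_RInt_Reals_0 in Hf.
  intros eps.
  (* Dividing by L + 1 instead of L covers L = 0. *)
  assert (Hd : 0 < eps / (L + 1))
    by (apply Rdiv_lt_0_compat; [apply cond_pos | lra]).
  destruct (Hf (mkposreal _ Hd)) as [phi [psi [Hphi Hpsi]]].
  destruct (step_scal L a b psi) as [psi' [Hval Hint]].
  exists (step_comp h phi), psi'; split.
  - intros t Ht; simpl; rewrite Hval.
    apply Rle_trans with (1 := Hh _ _).
    apply Rmult_le_compat_l; [exact HL | now apply Hphi].
  - rewrite Hint, Rabs_mult, (Rabs_pos_eq L) by exact HL.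
    simpl in Hpsi.
    apply Rle_lt_trans with (L * (eps / (L + 1))).
    + apply Rmult_le_compat_l; lra.
    + replace (pos eps) with ((L + 1) * (eps / (L + 1))) at 2 by (field; lra).
      apply Rmult_lt_compat_r; lra.
Qed.

Definition clamp (M x : R) : R := Rmax (- M) (Rmin M x).

Lemma clamp_bound (M x : R) : 0 <= M -> Rabs (clamp M x) <= M.
Proof.
  intros HM; unfold clamp; apply Rabs_le.
  unfold Rmax, Rmin; repeat destruct Rle_dec; lra.
Qed.

Lemma clamp_id (M x : R) : Rabs x <= M -> clamp M x = x.
Proof.
  intros Hx; apply Rabs_le_between in Hx; unfold clamp.
  rewrite Rmin_right, Rmax_right; lra.
Qed.

Lemma clamp_lipschitz (M x y : R) :
  0 <= M -> Rabs (clamp M x - clamp M y) <= Rabs (x - y).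
Proof.
  intros HM; unfold clamp, Rmax, Rmin, Rabs.
  repeat destruct Rle_dec; repeat destruct Rcase_abs; lra.
Qed.

(** Step functions approximating [f] may take values outside [-M, M], where
    [h] is uncontrolled; precomposing [h] with [clamp M] makes it globally
    Lipschitz without changing its composition with [f]. *)
Lemma ex_RInt_comp_lipschitz (f h : R -> R) (a b M L : R) :
  0 <= M -> 0 <= L ->
  (forall x, Rmin a b <= x <= Rmax a b -> Rabs (f x) <= M) ->
  (forall x y, Rabs x <= M -> Rabs y <= M ->
    Rabs (h x - h y) <= L * Rabs (x - y)) ->
  ex_RInt f a b -> ex_RInt (fun x => h (f x)) a b.
Proof.
  intros HM HL Hf Hh Hint.
  apply ex_RInt_ext with (fun x => h (clamp M (f x))).
  - intros x Hx; rewrite clamp_id; [reflexivity | apply Hf; lra].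
  - apply (ex_RInt_comp_lipschitz_global f (fun x => h (clamp M x)) a b L);
      [exact HL | | exact Hint].
    intros x y.
    apply Rle_trans with (L * Rabs (clamp M x - clamp M y)).
    + apply Hh; now apply clamp_bound.
    + apply Rmult_le_compat_l; [exact HL | now apply clamp_lipschitz].
Qed.

Lemma pow_lipschitz (m : nat) (M : R) :
  0 <= M ->
  exists L, 0 <= L /\
    forall x y, Rabs x <= M -> Rabs y <= M ->
      Rabs (x ^ m - y ^ m) <= L * Rabs (x - y).
Proof.
  intros HM; induction m as [|m [L [HL IH]]].
  - exists 0; split; [lra | intros x y _ _; simpl].
    rewrite Rminus_diag, Rabs_R0; lra.
  - exists (M * L + M ^ m); split.
    + apply Rplus_le_le_0_compat; [now apply Rmult_le_pos | now apply pow_le].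
    + intros x y Hx Hy; simpl.
      replace (x * x ^ m - y * y ^ m)
        with (x * (x ^ m - y ^ m) + y ^ m * (x - y)) by ring.
      apply Rle_trans with (1 := Rabs_triang _ _).
      rewrite !Rabs_mult, Rmult_plus_distr_r, Rmult_assoc.
      apply Rplus_le_compat.
      * apply Rmult_le_compat; auto using Rabs_pos.
      * apply Rmult_le_compat_r; [apply Rabs_pos |].
        rewrite <- RPow_abs; apply pow_incr; auto using Rabs_pos.
Qed.

Lemma ex_RInt_pow (f : R -> R) (a b : R) (m : nat) :
  ex_RInt f a b -> ex_RInt (fun x => f x ^ m) a b.
Proof.
  intros Hf.
  destruct (ex_RInt_ub f a b Hf) as [M HM].
  assert (HM0 : 0 <= M).
  { apply Rle_trans with (norm (f (Rmin a b))); [apply norm_ge_0 |].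
    apply HM; split; [lra | apply Rminmax]. }
  destruct (pow_lipschitz m M HM0) as [L [HL Hpow]].
  now apply (ex_RInt_comp_lipschitz f (fun y => y ^ m) a b M L).
Qed.

(** * Sample means as Riemann sums *)

Lemma Riemann_sum_right (g : R -> R) (t : nat -> R) (n k : nat) :
  Riemann_sum g (SF_seq_f2 (fun _ y => y) (seq.map t (seq.iota k (S n))))
  = sum_n_m (fun i => (t i - t (Nat.pred i)) * g (t i)) (S k) (k + n).
Proof.
  revert k; induction n as [|n IH]; intros k.
  - rewrite sum_n_m_zero by lia; reflexivity.
  - change (seq.map t (seq.iota k (S (S n))))
      with (cons (t k) (seq.map t (seq.iota (S k) (S n)))).
    rewrite SF_cons_f2 by (simpl; lia).
    rewrite Riemann_sum_cons, IH, (sum_Sn_m _ (S k)) by lia.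
    replace (k + S n)%nat with (S k + n)%nat by lia.
    reflexivity.
Qed.

Lemma sample_mean_Riemann_sum (g : R -> R) (n : nat) :
  Riemann_sum g (SF_seq_f2 (fun _ y => y) (unif_part 0 1 n)) = sample_mean g (S n).
Proof.
  unfold unif_part, seq.mkseq; rewrite Riemann_sum_right; unfold sample_mean.
  change (0 + S n)%nat with (S n).
  rewrite <- (sum_n_m_mult_l (K := R_Ring) (/ INR (S n))).
  apply sum_n_m_ext_loc; intros i Hi.
  change mult with Rmult; simpl mult.
  assert (HS : INR (S n) <> 0) by (apply not_0_INR; lia).
  rewrite <- S_INR.
  destruct i as [|i]; [lia |]; simpl Nat.pred.
  replace (0 + INR (S i) * (1 - 0) / INR (S n)) with (INR (S i) / INR (S n))
    by (field; exact HS).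
  f_equal.
  rewrite (S_INR i); field; exact HS.
Qed.

Lemma is_lim_seq_sample_mean (g : R -> R) :
  ex_RInt g 0 1 -> is_lim_seq (sample_mean g) (RInt g 0 1).
Proof.
  intros Hg; apply is_lim_seq_incr_1.
  apply is_lim_seq_spec; intros eps.
  destruct (proj1 (filterlim_locally _ _) (RInt_correct g 0 1 Hg) eps)
    as [delta Hdelta].
  assert (Hinv : is_lim_seq (fun n => / INR n) 0).
  { change (Finite 0) with (Rbar_inv p_infty).
    apply is_lim_seq_inv; [exact is_lim_seq_INR | discriminate]. }
  apply is_lim_seq_spec in Hinv; destruct (Hinv delta) as [N HN].
  exists N; intros n Hn.
  destruct (Riemann_fine_unif_part (fun _ y : R => y) 0 1 n)
    as (Hstep & Hptd & Hh & Hlast); [intros; lra | lra |].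
  (* The definition of [is_RInt] carries an orientation factor, here 1. *)
  rewrite <- sample_mean_Riemann_sum.
  rewrite <- (Rmult_1_l (Riemann_sum _ _)).
  rewrite <- (sign_eq_1 (1 - 0)) at 1 by lra.
  apply Hdelta.
  - apply Rle_lt_trans with (1 := Hstep).
    specialize (HN (S n) ltac:(lia)); rewrite S_INR in HN.
    apply Rabs_def2 in HN as [HN _]; unfold Rdiv.
    replace ((1 - 0) * / (INR n + 1)) with (/ (INR n + 1) - 0) by ring.
    exact HN.
  - rewrite Rmin_left, Rmax_right by lra; auto.
Qed.

(** * The sum of the entries of a min/max matrix *)

Lemma sum_n_m_square_border (a : nat -> nat -> R) (n : nat) :
  (forall i j, a i j = a j i) ->
  sum_n_m (fun i => sum_n_m (fun j => a i j) 1 (S n)) 1 (S n)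
  = sum_n_m (fun i => sum_n_m (fun j => a i j) 1 n) 1 n
    + (2 * sum_n_m (fun i => a i (S n)) 1 (S n) - a (S n) (S n)).
Proof.
  intros Hsym.
  rewrite sum_n_Sm by lia.
  rewrite (sum_n_m_ext_loc _ (fun i => plus (sum_n_m (fun j => a i j) 1 n) (a i (S n))))
    by (intros; apply sum_n_Sm; lia).
  rewrite sum_n_m_plus.
  rewrite (sum_n_m_ext_loc (fun j => a (S n) j) (fun j => a j (S n)))
    by (intros; apply Hsym).
  rewrite (sum_n_Sm (fun i => a i (S n))) by lia.
  change plus with Rplus; simpl; ring.
Qed.

Lemma norm_pow_minmax (m : nat) (f : R -> R) (n : nat) :
  norm_pow m (minmax_matrix f n)
  = sum_n_m (fun i => sum_n_m (fun j =>
      Rabs (f (INR (Nat.min i j) / INR (Nat.max i j))) ^ m) 1 n) 1 n.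
Proof.
  unfold norm_pow, minmax_matrix.
  apply sum_n_m_ext_loc; intros i Hi.
  apply sum_n_m_ext_loc; intros j Hj.
  rewrite coeff_mat_bij by lia.
  destruct i as [|i]; [lia |]; destruct j as [|j]; [lia |].
  reflexivity.
Qed.

(** On the border of the square of side [n], the larger index is [n], so the
    entries of the last column are the samples of [g] that [sample_mean g n]
    averages, and the corner entry is [g 1]. *)
Lemma sum_minmax_sample_mean (g : R -> R) (n : nat) :
  sum_n_m (fun i => sum_n_m (fun j =>
    g (INR (Nat.min i j) / INR (Nat.max i j))) 1 (S n)) 1 (S n)
  = sum_f_R0 (fun k => 2 * INR (S k) * sample_mean g (S k) - g 1) n.
Proof.
  assert (Hborder : forall n,
    sum_n_m (fun i => g (INR (Nat.min i (S n)) / INR (Nat.max i (S n)))) 1 (S n)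
    = INR (S n) * sample_mean g (S n)).
  { intros k; unfold sample_mean.
    rewrite <- Rmult_assoc, Rinv_r, Rmult_1_l by (apply not_0_INR; lia).
    apply sum_n_m_ext_loc; intros i Hi.
    now rewrite Nat.min_l, Nat.max_r by lia. }
  assert (Hdiag : forall n,
    INR (Nat.min (S n) (S n)) / INR (Nat.max (S n) (S n)) = 1).
  { intros k; rewrite Nat.min_id, Nat.max_id.
    apply Rinv_r; apply not_0_INR; lia. }
  (* The sums live in an abelian monoid whose carrier is only convertible to
     [R]; [ring] needs the equality at [R] itself. *)
  induction n as [|n IH];
    rewrite (sum_n_m_square_border
      (fun i j => g (INR (Nat.min i j) / INR (Nat.max i j))))
      by (intros; now rewrite Nat.min_comm, Nat.max_comm);
    rewrite Hborder, Hdiag.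
  - rewrite (sum_n_m_zero _ 1 0) by lia.
    match goal with |- ?x = ?y => change (@eq R x y) end.
    change zero with 0; simpl; ring.
  - rewrite IH, tech5.
    match goal with |- ?x = ?y => change (@eq R x y) end.
    ring.
Qed.

Lemma sum_odd (n : nat) :
  sum_f_R0 (fun k => 2 * INR k + 1) n = INR (S n) ^ 2.
Proof.
  induction n as [|n IH]; [simpl; ring |].
  rewrite tech5, IH, (S_INR (S n)); ring.
Qed.

(** Dividing the sum of the terms [2 * (k+1) * S - g 1] by the sum of the odd
    numbers [2 * k + 1], where [S = sample_mean g (k+1)], is a weighted Cesaro
    mean of the quotients [B k]. *)
Lemma is_lim_seq_minmax_mean (g : R -> R) (l : R) :
  is_lim_seq (sample_mean g) l ->
  is_lim_seq (fun n => / INR n ^ 2 *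
    sum_n_m (fun i => sum_n_m (fun j =>
      g (INR (Nat.min i j) / INR (Nat.max i j))) 1 n) 1 n) l.
Proof.
  intros Hl; apply is_lim_seq_incr_1.
  (* B k = (2 (k+1) S - g 1) / (2 k + 1), since 2 (k+1) = (2 k + 1) + 1. *)
  set (B := fun k => sample_mean g (S k)
                     + (sample_mean g (S k) - g 1) * / (2 * INR k + 1)).
  assert (Hodd : forall k, 0 < 2 * INR k + 1)
    by (intros k; pose proof (pos_INR k); lra).
  assert (HB : is_lim_seq B l).
  { apply is_lim_seq_incr_1 in Hl.
    replace (Finite l) with (Finite (l + (l - g 1) * 0)) by (f_equal; ring).
    apply is_lim_seq_plus'; [exact Hl |].
    apply is_lim_seq_mult'.
    - apply is_lim_seq_minus'; [exact Hl | apply is_lim_seq_const].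
    - replace (Finite 0) with (Rbar_inv p_infty) by reflexivity.
      apply is_lim_seq_inv; [| discriminate].
      apply is_lim_seq_le_p_loc with INR; [| exact is_lim_seq_INR].
      exists 0%nat; intros k _; pose proof (pos_INR k); lra. }
  assert (Hinf : cv_infty (sum_f_R0 (fun k => 2 * INR k + 1))).
  { intros M; destruct (INR_unbounded M) as [N HN].
    exists N; intros n Hn; rewrite sum_odd.
    apply Rlt_le_trans with (1 := HN).
    apply Rle_trans with (INR (S n)); [apply le_INR; lia |].
    rewrite S_INR; pose proof (pos_INR n); nra. }
  apply is_lim_seq_Reals in HB.
  pose proof (Cesaro (fun k => 2 * INR k + 1) B l HB Hodd Hinf) as Hces.
  apply is_lim_seq_Reals in Hces; revert Hces.
  apply is_lim_seq_ext; intros n.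
  rewrite sum_minmax_sample_mean, sum_odd.
  unfold Rdiv; rewrite Rmult_comm; f_equal.
  apply sum_eq; intros k _; unfold B; rewrite (S_INR k).
  field; apply Rgt_not_eq, Hodd.
Qed.

(* [ex_RInt f 0 1] is proper Riemann integrability; f is then bounded on
   [0,1] and therefore belongs to L^m[0,1] for every m.

   For odd m and f taking negative values, the limit of the norms is the
   integral of |f|^m and not that of f^m.  The three clauses are: the second
   equality for f^m, without restriction; the first equality for f^m, when
   f^m = |f|^m; both equalities for |f|^m, without restriction. *)
Theorem mainTheorem2 :
  forall (m : nat) (f : R -> R),
    (1 <= m)%nat ->
    ex_RInt f 0 1 ->
    (ex_RInt (fun x : R => f x ^ m) 0 1 /\
     is_lim_seq (fun n : nat => sample_mean (fun x : R => f x ^ m) n)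
                (RInt (fun x : R => f x ^ m) 0 1)) /\
    (Nat.Even m \/ (forall x : R, 0 <= x <= 1 -> 0 <= f x) ->
     is_lim_seq (fun n : nat => / INR n ^ 2 * norm_pow m (minmax_matrix f n))
                (RInt (fun x : R => f x ^ m) 0 1)) /\
    (ex_RInt (fun x : R => Rabs (f x) ^ m) 0 1 /\
     is_lim_seq (fun n : nat => / INR n ^ 2 * norm_pow m (minmax_matrix f n))
                (RInt (fun x : R => Rabs (f x) ^ m) 0 1) /\
     is_lim_seq (fun n : nat => sample_mean (fun x : R => Rabs (f x) ^ m) n)
                (RInt (fun x : R => Rabs (f x) ^ m) 0 1)).

  intros m f _ Hf.
  assert (Habs : ex_RInt (fun x => Rabs (f x) ^ m) 0 1)
    by (apply ex_RInt_pow; exact (ex_RInt_norm f 0 1 Hf)).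
  assert (Hpow := ex_RInt_pow f 0 1 m Hf).
  assert (Hmean := is_lim_seq_sample_mean _ Habs).
  assert (Hnorm :
    is_lim_seq (fun n => / INR n ^ 2 * norm_pow m (minmax_matrix f n))
               (RInt (fun x => Rabs (f x) ^ m) 0 1)).
  { apply is_lim_seq_ext with (2 := is_lim_seq_minmax_mean _ _ Hmean).
    intros n; now rewrite norm_pow_minmax. }
  split; [split; [exact Hpow | exact (is_lim_seq_sample_mean _ Hpow)] |].
  split; [| auto].
  intros Hsign.
  rewrite (RInt_ext _ (fun x => Rabs (f x) ^ m)); [exact Hnorm |].
  intros x Hx; rewrite Rmin_left, Rmax_right in Hx by lra.
  destruct Hsign as [[p ->] | Hpos].
  - now rewrite !pow_mult, pow2_abs.
  - rewrite Rabs_pos_eq; [reflexivity | apply Hpos; lra].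
Qed.
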